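(* Let $n$ be a positive integer. Part 1. If $n \le 2$, then there is an algorithm that, on every instance of the submission limit problem with $n$ authors (with any finite set of papers and any submission limit $x \in \mathbb{N}_+$), outputs an ideal desk-rejection; in particular every such instance has an ideal desk-rejection. Part 2. If $n \ge 3$, then there exists at least one instance of the submission limit problem with $n$ authors for which no algorithm can achieve an ideal desk-rejection, i.e. for which no ideal desk-rejection $S$ exists.
   Context: An instance of the submission limit problem consists of a set of $n$ authors $\mathcal{A} = \{a_1,\dots,a_n\}$, a set of $m$ papers $\mathcal{P} = \{p_1,\dots,p_m\}$, for each paper $p_j$ a set of authors $A_j \subseteq \mathcal{A}$, and a submission limit $x \in \mathbb{N}_+ = \{1,2,3,\dots\}$. For each author $a_i$, $P_i = \{p_j \in \mathcal{P} : a_i \in A_j\}$ denotes the set of papers of $a_i$. The task is to choose a subset $S \subseteq \mathcal{P}$ of papers to keep (the others are desk-rejected) such that $|\{p_j \in S : a_i \in A_j\}| \le x$ for every $a_i \in \mathcal{A}$. An ideal desk-rejection for the instance is a subset $S \subseteq \mathcal{P}$ of kept papers such that every author has exactly $\min\{x, |P_i|\}$ papers remaining, i.e. $|\{p_j \in S : a_i \in A_j\}| = \min\{x, |P_i|\}$ for every $a_i \in \mathcal{A}$. *)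

(* Defs.v *)
From mathcomp Require Import all_boot.
Set Implicit Arguments.
Unset Strict Implicit.
Unset Printing Implicit Defensive.

(** * Instances of the submission limit problem *)

(* Papers are indices, so distinct papers may have the same set of authors. *)
Record instance (n : nat) := Instance {
  npapers : nat;
  authors : 'I_npapers -> {set 'I_n};
  limit : nat;
  limit_gt0 : 0 < limit
}.

Definition papers_of n (I : instance n) (a : 'I_n) : {set 'I_(npapers I)} :=
  [set p | a \in authors p].

(* S is the set of papers that are kept. *)
Definition ideal n (I : instance n) (S : {set 'I_(npapers I)}) : Prop :=
  forall a : 'I_n,
    #|[set p in S | a \in authors p]| = minn (limit I) #|papers_of I a|.

Arguments ideal {n} I S.

(** * Algorithms *)

(* Algorithms are programs of N. D. Jones' WHILE language ("Computability and
   Complexity from a Programming Perspective"), a Turing-complete language whose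
   only data type is that of binary trees.  An arbitrary Rocq function would not
   do: with the axiom of choice it carries no computability content. *)

Inductive tree := Leaf | Node of tree & tree.

Definition left_tree (t : tree) := if t is Node l _ then l else Leaf.
Definition right_tree (t : tree) := if t is Node _ r then r else Leaf.
Definition truthy (t : tree) : bool := if t is Node _ _ then true else false.

Inductive expr :=
  | Var of nat
  | Nil
  | Cons of expr & expr
  | Hd of expr
  | Tl of expr.

Inductive program :=
  | Skip
  | Assign of nat & expr
  | Seq of program & program
  | If of expr & program & program
  | While of expr & program.

Definition store := nat -> tree.

Definition update (s : store) (x : nat) (t : tree) : store :=
  fun y => if y == x then t else s y.

Fixpoint eval (s : store) (e : expr) : tree :=
  match e with
  | Var x => s x
  | Nil => Leaf
  | Cons e1 e2 => Node (eval s e1) (eval s e2)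
  | Hd e1 => left_tree (eval s e1)
  | Tl e1 => right_tree (eval s e1)
  end.

(* [exec c s s']: started in s, the program c terminates in s'. *)
Inductive exec : program -> store -> store -> Prop :=
  | ExecSkip s : exec Skip s s
  | ExecAssign s x e : exec (Assign x e) s (update s x (eval s e))
  | ExecSeq c1 c2 s s1 s2 :
      exec c1 s s1 -> exec c2 s1 s2 -> exec (Seq c1 c2) s s2
  | ExecIf e c1 c2 s s' :
      exec (if truthy (eval s e) then c1 else c2) s s' ->
      exec (If e c1 c2) s s'
  | ExecWhileDone e c s :
      ~~ truthy (eval s e) -> exec (While e c) s s
  | ExecWhileStep e c s s1 s2 :
      truthy (eval s e) -> exec c s s1 -> exec (While e c) s1 s2 ->
      exec (While e c) s s2.

(* Variable 0 holds both the input and the output; all others start as Leaf. *)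
Definition outputs (c : program) (input output : tree) : Prop :=
  exists2 s : store, exec c (update (fun=> Leaf) 0 input) s & s 0 = output.

Lemma exec_det c s s1 s2 : exec c s s1 -> exec c s s2 -> s1 = s2.
Proof.
move=> H; elim: H s2 => {c s s1}.
- by move=> s s2 H; inversion H.
- by move=> s x e s2 H; inversion H.
- move=> c1 c2 s s1 s2 _ IH1 _ IH2 s3 H.
  inversion H as [| |? ? ? t ? E1 E2| | |]; subst.
  by apply: IH2; rewrite (IH1 _ E1).
- by move=> e c1 c2 s s' _ IH s2 H; inversion H; subst; apply: IH.
- move=> e c s /negbTE He s2 H.
  inversion H as [| | | | |? ? ? ? ? Ht]; subst => //.
  by rewrite He in Ht.
- move=> e c s s1 s2 He _ IH1 _ IH2 s3 H.
  inversion H as [| | | |? ? ? Hf|? ? ? t ? Ht E1 E2]; subst.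
    by rewrite He in Hf.
  by apply: IH2; rewrite (IH1 _ E1).
Qed.

Lemma outputs_det c input output1 output2 :
  outputs c input output1 -> outputs c input output2 -> output1 = output2.
Proof.
by move=> [s1 H1 <-] [s2 H2 <-]; rewrite (exec_det H1 H2).
Qed.

(** * Encoding of instances and of sets of papers *)

Definition enc_bool (b : bool) : tree := if b then Node Leaf Leaf else Leaf.
Definition enc_seq (s : seq tree) : tree := foldr Node Leaf s.
Definition enc_nat (k : nat) : tree := enc_seq (nseq k Leaf).

(* A subset of 'I_k as the list of the k values of its indicator function. *)
Definition enc_set k (A : {set 'I_k}) : tree :=
  enc_seq [seq enc_bool (i \in A) | i <- enum 'I_k].

(* The submission limit, in unary, paired with the list of author sets. *)
Definition enc_instance n (I : instance n) : tree :=
  Node (enc_nat (limit I))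
       (enc_seq [seq enc_set (authors p) | p <- enum 'I_(npapers I)]).

Definition solves_ideally n (c : program) : Prop :=
  forall I : instance n,
    exists2 S : {set 'I_(npapers I)},
      ideal I S & outputs c (enc_instance I) (enc_set S).

(* Main.v *)
(** For [n <= 2] a paper has either both authors, one of them, or none.  Keep as
    many joint papers as the limit [x] allows; if there are [J] of them, then keep
    up to [x - J] papers of each single author.  An author with [s] papers of his
    own then has [minn x J + minn (x - J) s = minn x (J + s)] papers left.  For
    [n >= 3], take the three papers written by two of the authors 0, 1, 2, with
    limit 1: for each paper [p], an ideal [S] would contain exactly one paper other
    than [p], so [#|S|] would be 1 or 2 according to whether [p] is in [S]; hence [S] would
    be empty or full, of size 0 or 3. *)

From mathcomp Require Import all_boot.
From mathcomp Require Import zify.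
(* Required last, so that [Cons] and [Nil] are expressions and not sequences. *)
Require Import Defs.


Set Implicit Arguments.
Unset Strict Implicit.
Unset Printing Implicit Defensive.

(** * Keeping a bounded number of elements of each class *)

Section Keep.
Variables (T : Type) (class : T -> nat) (cap : nat -> nat).

Definition class_count (s : seq T) (k : nat) : nat :=
  count (fun x => class x == k) s.

(** Elements near the end of the list have priority: the test counts the later elements of the same
    class. This matches the second loop of the program, which consumes the reversed list. *)
Fixpoint keep (s : seq T) : seq bool :=
  if s is x :: s' then
    (class_count s' (class x) < cap (class x)) :: keep s'
  else [::].

Lemma size_keep s : size (keep s) = size s.
Proof. by elim: s => //= x s ->. Qed.

Lemma class_count_keep s k :
  class_count (mask (keep s) s) k = minn (cap k) (class_count s k).
Proof.
elim: s => [|x s IH]; first by rewrite minn0.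
rewrite /class_count /=; case: ifP => Hx /=; rewrite -!/(class_count _ _) IH;
  case: (class x =P k) => [E|_] //; move: Hx; rewrite E; lia.
Qed.

End Keep.

Lemma count_class2 (T : Type) (class : T -> nat) (P : pred T) k1 k2 s :
  k1 != k2 -> (forall x, P x = (class x == k1) || (class x == k2)) ->
  count P s = class_count class s k1 + class_count class s k2.
Proof.
move=> ne HP; rewrite /class_count -count_predUI.
rewrite [X in _ + X](_ : _ = 0) ?addn0; first by apply: eq_count.
rewrite -(count_pred0 s); apply: eq_count => x /=.
by case: eqP => //= ->; apply/negbTE.
Qed.

Lemma card_set_mask m (b : seq bool) (P : pred 'I_m) :
  #|[set p in [set q in mask b (enum 'I_m)] | P p]| = count P (mask b (enum 'I_m)).
Proof.
rewrite -size_filter -(card_uniqP _); last first.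
  by rewrite filter_uniq // mask_uniq // enum_uniq.
by apply: eq_card => p; rewrite !inE mem_filter andbC.
Qed.

Lemma indicator_mask m (b : seq bool) :
  size b = m -> [seq i \in [set q in mask b (enum 'I_m)] | i <- enum 'I_m] = b.
Proof.
move=> Hb; apply: (@eq_from_nth _ false); first by rewrite size_map size_enum_ord.
move=> i; rewrite size_map size_enum_ord => Hi.
rewrite (nth_map (Ordinal Hi)) ?size_enum_ord // inE in_mask ?enum_uniq //.
by rewrite mem_enum /= index_enum_ord nth_enum_ord.
Qed.

(** * Running programs *)

Fixpoint loop_free (c : program) : bool :=
  match c with
  | Skip | Assign _ _ => true
  | Seq c1 c2 | If _ c1 c2 => loop_free c1 && loop_free c2
  | While _ _ => false
  end.

(* Meaningful for loop-free programs only: loops are skipped. *)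
Fixpoint run (c : program) (s : store) : store :=
  match c with
  | Skip | While _ _ => s
  | Assign x e => update s x (eval s e)
  | Seq c1 c2 => run c2 (run c1 s)
  | If e c1 c2 => if truthy (eval s e) then run c1 s else run c2 s
  end.

Lemma exec_run c s : loop_free c -> exec c s (run c s).
Proof.
elim: c s => [|x e|c1 IH1 c2 IH2|e c1 IH1 c2 IH2|//] s /=.
- by move=> _; apply: ExecSkip.
- by move=> _; apply: ExecAssign.
- by case/andP=> H1 H2; apply: ExecSeq (IH1 _ H1) (IH2 _ H2).
- by case/andP=> H1 H2; apply: ExecIf; case: ifP => _; [apply: IH1|apply: IH2].
Qed.

Lemma iter_right_enc_seq k s : iter k right_tree (enc_seq s) = enc_seq (drop k s).
Proof.
elim: k s => [|k IH] s; first by rewrite drop0.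
by rewrite iterSr; case: s => [|x s] /=; rewrite -?IH // (IH [::]).
Qed.

Lemma left_enc_seq s : left_tree (enc_seq s) = nth Leaf s 0.
Proof. by case: s. Qed.

(** [Tl] fixes [Leaf], so decrementing a unary counter truncates at 0, as subtraction on [nat]
    does. *)
Lemma right_enc_nat k : right_tree (enc_nat k) = enc_nat k.-1.
Proof. by case: k. Qed.

Lemma truthy_enc_nat k : truthy (enc_nat k) = (0 < k).
Proof. by case: k. Qed.

Definition has_author (k : nat) (t : tree) : bool :=
  truthy (left_tree (iter k right_tree t)).

Lemma has_author_enc n (A : {set 'I_n}) (a : 'I_n) :
  has_author a (enc_set A) = (a \in A).
Proof.
rewrite /has_author iter_right_enc_seq left_enc_seq nth_drop addn0.
by rewrite (nth_map a) ?size_enum_ord // nth_ord_enum; case: (a \in A).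
Qed.

(** * The algorithm for at most two authors *)

(* The class of a paper is the program variable that counts how many papers of
   this class may still be kept: 3 for joint papers, 4 and 5 for the papers of a
   single author.  Variable 6 is never assigned, so papers without author are
   rejected. *)
Definition paper_class (t : tree) : nat :=
  if has_author 0 t then if has_author 1 t then 3 else 4
  else if has_author 1 t then 5 else 6.

Definition by_class (x : nat) (c : nat -> program) : program :=
  If (Hd (Hd (Var x)))
     (If (Hd (Tl (Hd (Var x)))) (c 3) (c 4))
     (If (Hd (Tl (Hd (Var x)))) (c 5) (c 6)).

Lemma run_by_class x c s :
  run (by_class x c) s = run (c (paper_class (left_tree (s x)))) s.
Proof.
by rewrite /paper_class /has_author /=; do 2!case: (truthy (left_tree _)).
Qed.

Definition count_body : program :=
  Seq (by_class 1 (fun k => if k == 3 then Assign 4 (Tl (Var 4)) else Skip))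
      (Seq (Assign 2 (Cons (Hd (Var 1)) (Var 2))) (Assign 1 (Tl (Var 1)))).

Definition decide (k : nat) : program :=
  If (Var k)
     (Seq (Assign 0 (Cons (Cons Nil Nil) (Var 0))) (Assign k (Tl (Var k))))
     (Assign 0 (Cons Nil (Var 0))).

Definition keep_body : program := Seq (by_class 2 decide) (Assign 2 (Tl (Var 2))).

(* The first loop subtracts the number of joint papers from the limit and
   reverses the list of papers, so that the second loop can build its output by
   [Cons] in the original order. *)
Definition desk_reject : program :=
  Seq (Seq (Assign 3 (Hd (Var 0)))
      (Seq (Assign 4 (Hd (Var 0)))
      (Seq (Assign 1 (Tl (Var 0))) (Assign 0 Nil))))
  (Seq (While (Var 1) count_body)
  (Seq (Assign 5 (Var 4)) (While (Var 2) keep_body))).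

Section Correctness.
Variables (T : Type) (enc : T -> tree).
Let class (x : T) : nat := paper_class (enc x).
Let enc_list (s : seq T) : tree := enc_seq (map enc s).

Lemma exec_count_loop s r l st :
  st 1 = enc_list s -> st 2 = enc_list r -> st 4 = enc_nat l ->
  exists2 st', exec (While (Var 1) count_body) st st' &
    [/\ st' 2 = enc_list (catrev s r), st' 4 = enc_nat (l - class_count class s 3) &
        [/\ st' 0 = st 0, st' 3 = st 3 & st' 6 = st 6]].
Proof.
elim: s r l st => [|x s IH] r l st H1 H2 H4.
  by exists st; [apply: ExecWhileDone; rewrite /= H1 | rewrite subn0].
pose st1 := run count_body st.
have E : exec count_body st st1 by apply: exec_run.
pose st0 := if class x == 3 then update st 4 (enc_nat l.-1) else st.
have D : st1 = update (update st0 2 (enc_list (x :: r))) 1 (enc_list s).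
  rewrite /st1 /count_body /run -/run run_by_class H1 /= -/(class x) /st0.
  by case: (class x == 3); rewrite /= /update /= H1 H2 ?H4 ?right_enc_nat.
(* [class x == 3] coerces to 0 or 1, the amount that this iteration subtracts from variable 4. *)
have [|||st' Hst' [K2 K4 [K0 K3 K6]]] := IH (x :: r) (l - (class x == 3)) st1.
- by rewrite D.
- by rewrite D.
- by rewrite D /st0 /update /=; case: (class x == 3); rewrite ?subn1 ?subn0.
exists st'; first by apply: ExecWhileStep E Hst'; rewrite /= H1.
split=> //; first by rewrite K4 /class_count /= subnDA.
by rewrite K0 K3 K6 D /st0; case: (class x == 3).
Qed.

Variable cap : nat -> nat.

(** Loop invariant: [s'] is the suffix already decided, [s] the prefix still to be read from its
    end, and each counter holds the capacity left in its class. Hence the induction on [s] from the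
    right. *)
Lemma exec_keep_loop s s' st :
  st 2 = enc_list (rev s) ->
  st 0 = enc_seq (map enc_bool (keep class cap s')) ->
  (forall k, 2 < k <= 6 -> st k = enc_nat (cap k - class_count class s' k)) ->
  exists2 st', exec (While (Var 2) keep_body) st st' &
    st' 0 = enc_seq (map enc_bool (keep class cap (s ++ s'))).
Proof.
elim/last_ind: s s' st => [|s x IH] s' st H2 H0 Hk.
  by exists st; [apply: ExecWhileDone; rewrite /= H2 |].
rewrite rev_rcons in H2; rewrite cat_rcons.
pose st1 := run keep_body st.
have E : exec keep_body st st1 by apply: exec_run.
(* Separates the counter of [x] from variables 0 and 2, which hold the output and the remaining
   papers. *)
have class_bounds : 2 < class x <= 6.
  by rewrite /class /paper_class; do 2!case: has_author.
have D j : st1 j = if j == 2 then enc_list (rev s) else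
    if j == class x then enc_nat (cap j - class_count class (x :: s') j) else
    if j == 0 then enc_seq (map enc_bool (keep class cap (x :: s'))) else st j.
  rewrite /st1 /keep_body /run -/run run_by_class H2 /= -/(class x).
  rewrite Hk // truthy_enc_nat subn_gt0 /class_count /= -/(class_count _ _ _).
  move: class_bounds Hk; move: (class x) => c cb Hk.
  have [c0 c2] : (c == 0) = false /\ (c == 2) = false by lia.
  case: ltnP => Hc; rewrite /= /update /= ?c0 ?(eq_sym 2) ?c2 ?H2 /=;
    case: (j =P 2) => //= _; case: (j =P c) => [->|//]; rewrite ?c0 ?eqxx ?H0 ?(Hk c) //.
  - by rewrite right_enc_nat add1n subnS /class_count.
  (* A rejected paper leaves its counter alone: the class is exhausted, so the truncated difference
     is 0 with or without [x]. *)
  - by congr enc_nat; rewrite /class_count in Hc *; lia.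
have [|||st' Hst' K] := IH (x :: s') st1.
- by rewrite D.
- by rewrite D /=; case: (0 =P class x) class_bounds => // <-.
- move=> k kb; rewrite D; have [-> ->] : (k == 2) = false /\ (k == 0) = false by lia.
  case: (k =P class x) => // /eqP; rewrite eq_sym => /negbTE ne.
  by rewrite Hk // /class_count /= ne.
by exists st' => //; apply: ExecWhileStep E Hst'; rewrite /= H2.
Qed.

End Correctness.

(** [joint] counts all joint papers, kept or not: if it exceeds [x], truncation leaves no room for
    single-author papers. *)
Definition capacity (x joint k : nat) : nat :=
  if k == 3 then x else if k == 6 then 0 else x - joint.

Lemma outputs_desk_reject (T : Type) (enc : T -> tree) (x : nat) (s : seq T) :
  let class y := paper_class (enc y) in
  outputs desk_reject (Node (enc_nat x) (enc_seq (map enc s)))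
    (enc_seq (map enc_bool (keep class (capacity x (class_count class s 3)) s))).
Proof.
move=> class; set input := Node _ _; set J := class_count class s 3.
pose init := Seq (Assign 3 (Hd (Var 0))) (Seq (Assign 4 (Hd (Var 0)))
                 (Seq (Assign 1 (Tl (Var 0))) (Assign 0 Nil))).
pose st0 := run init (update (fun=> Leaf) 0 input).
have [//|//|//|st1 E1 [K2 K4 [K0 K3 K6]]] :=
  @exec_count_loop T enc s [::] x st0.
pose st2 := update st1 5 (st1 4).
have [|||st' E2 K] :=
  @exec_keep_loop T enc (capacity x J) s [::] st2.
- by rewrite /st2 /update /= K2 /rev.
- by rewrite /st2 /update /= K0.
- move=> k kb; rewrite subn0 /st2 /update.
  have [->|[->|[->|->]]] : k = 3 \/ k = 4 \/ k = 5 \/ k = 6 by lia.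
  + by rewrite /= K3.
  + by rewrite /= K4.
  + by rewrite /= K4.
  + by rewrite /= K6.
exists st'; last by rewrite K cats0.
apply: (@ExecSeq _ _ _ st0); first exact: exec_run.
apply: ExecSeq E1 _; apply: (@ExecSeq _ _ _ st2) E2; exact: ExecAssign.
Qed.

Lemma author_classes n (A : {set 'I_n}) (a : 'I_n) : n <= 2 ->
  (a \in A) = (paper_class (enc_set A) == 3) || (paper_class (enc_set A) == 4 + a).
Proof.
move=> n2; rewrite -has_author_enc /paper_class.
have [->|->] : a = 0 :> nat \/ a = 1 :> nat by have := ltn_ord a; lia.
  by do 2!case: has_author.
by do 2!case: has_author.
Qed.

Lemma desk_reject_solves n : n <= 2 -> solves_ideally n desk_reject.
Proof.
move=> n2 I; pose class (p : 'I_(npapers I)) := paper_class (enc_set (authors p)).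
set e := enum 'I_(npapers I).
pose cap := capacity (limit I) (class_count class e 3).
exists [set p in mask (keep class cap e) e]; last first.
  rewrite /enc_set map_comp indicator_mask ?size_keep ?size_enum_ord //.
  exact: (@outputs_desk_reject _ (fun p => enc_set (authors p)) (limit I) e).
move=> a; rewrite card_set_mask.
have split_count s : count (fun p => a \in authors p) s =
    class_count class s 3 + class_count class s (4 + a).
  by apply: count_class2 => // p; apply: author_classes.
have -> : #|papers_of I a| = count (fun p => a \in authors p) e.
  by rewrite cardsE cardE size_filter /e enumT.
rewrite !split_count !class_count_keep /cap /capacity /=.
have := ltn_ord a; case: ifP; lia.
Qed.

(** * Three authors or more *)

Definition triangle (n : nat) : instance n :=
  @Instance n 3 (fun p => [set a : 'I_n | (a < 3) && (a != p :> nat)]) 1 isT.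

Lemma triangle_not_ideal n (S : {set 'I_3}) : 3 <= n -> ~ @ideal n (triangle n) S.
Proof.
move=> n3 idS.
(* Author [p] writes exactly the two papers other than [p], so [S :\ p] is what this author keeps,
   of size [minn 1 2]. *)
have cardS (p : 'I_3) : #|S| = (p \in S) + 1.
  have := idS (widen_ord n3 p); rewrite /papers_of /= => H.
  rewrite (cardsD1 p); congr (_ + _).
  transitivity (minn 1 #|[set~ p]|); last by rewrite cardsC1 card_ord.
  rewrite (_ : S :\ p = [set q in S | widen_ord n3 p \in
      [set a : 'I_n | (a < 3) && (a != q :> nat)]]); last first.
    by apply/setP=> q; rewrite !inE /= ltn_ord andbC eq_sym.
  rewrite H; congr (minn _ _); apply: eq_card => q.
  by rewrite !inE /= ltn_ord eq_sym.
have [S0|[p pS]] := set_0Vmem S.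
  by have := cardS ord0; rewrite S0 cards0 inE.
have ST : S = setT.
  apply/setP=> q; rewrite inE; have := cardS q; rewrite (cardS p) pS.
  by case: (q \in S).
by have := cardS ord0; rewrite ST cardsT card_ord inE.
Qed.

Theorem theorem4p3 (n : nat) (hn : 0 < n) :
  (n <= 2 ->
     (exists c : program, solves_ideally n c) /\
     (forall I : instance n, exists S : {set 'I_(npapers I)}, ideal I S)) /\
  (3 <= n ->
     exists I : instance n, ~ exists S : {set 'I_(npapers I)}, ideal I S).
Proof.
split=> [n2|n3].
  have H := desk_reject_solves n2; split; first by exists desk_reject.
  by move=> I; have [S idS _] := H I; exists S.
by exists (triangle n) => -[S]; apply: triangle_not_ideal.
Qed.
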